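(* Let $(M,\alpha_M)$ and $(N,\alpha_N)$ be Hom-Leibniz algebras over a field $\mathbb{K}$ acting compatibly on each other. Then the Hom-vector space $(M\ast N,\alpha_{M\ast N})$ endowed with the bracket operation given on generators by $$[m\ast n,m'\ast n']=m^n\ast{}^{m'}n',\qquad [m\ast n,n'\ast m']=m^n\ast n'^{\,m'},$$ $$[n\ast m,m'\ast n']={}^nm\ast{}^{m'}n',\qquad [n\ast m,n'\ast m']={}^nm\ast n'^{\,m'}$$ ($m,m'\in M$, $n,n'\in N$) is a Hom-Leibniz algebra.
   Context: Vector spaces and linear maps are over a fixed field $\mathbb{K}$. A Hom-vector space $(V,\alpha_V)$ is a vector space with a linear map $\alpha_V:V\to V$. A Hom-Leibniz algebra $(L,\alpha_L)$ is a vector space $L$ with a bilinear bracket $[-,-]:L\times L\to L$ and a linear map $\alpha_L:L\to L$ such that $[\alpha_L(x),[y,z]]=[[x,y],\alpha_L(z)]-[[x,z],\alpha_L(y)]$ and (multiplicativity, always assumed) $\alpha_L[x,y]=[\alpha_L(x),\alpha_L(y)]$ for all $x,y,z\in L$. A Hom-Leibniz action of $(L,\alpha_L)$ on $(M,\alpha_M)$ is a pair of linear maps $L\otimes M\to M$, $x\otimes m\mapsto{}^xm$, and $M\otimes L\to M$, $m\otimes x\mapsto m^x$, such that for all $x,y\in L$, $m,m'\in M$: (a) $\alpha_M(m)^{[x,y]}=(m^x)^{\alpha_L(y)}-(m^y)^{\alpha_L(x)}$; (b) ${}^{[x,y]}\alpha_M(m)=({}^xm)^{\alpha_L(y)}-{}^{\alpha_L(x)}(m^y)$;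 (c) ${}^{\alpha_L(x)}({}^ym)=-{}^{\alpha_L(x)}(m^y)$; (d) ${}^{\alpha_L(x)}[m,m']=[{}^xm,\alpha_M(m')]-[{}^xm',\alpha_M(m)]$; (e) $[m,m']^{\alpha_L(x)}=[m^x,\alpha_M(m')]+[\alpha_M(m),m'^{\,x}]$; (f) $[\alpha_M(m),{}^xm']=-[\alpha_M(m),m'^{\,x}]$; (g) $\alpha_M({}^xm)={}^{\alpha_L(x)}\alpha_M(m)$; (h) $\alpha_M(m^x)=\alpha_M(m)^{\alpha_L(x)}$. Actions of $(M,\alpha_M)$ and $(N,\alpha_N)$ on each other are compatible if for all $m,m'\in M$, $n,n'\in N$: ${}^{({}^mn)}m'=[m^n,m']$, ${}^{({}^nm)}n'=[n^m,n']$, ${}^{(n^m)}m'=[{}^nm,m']$, ${}^{(m^n)}n'=[{}^mn,n']$, $m^{({}^{m'}n)}=[m,m'^{\,n}]$, $n^{({}^{n'}m)}=[n,n'^{\,m}]$, $m^{(n^{m'})}=[m,{}^nm']$, $n^{(m^{n'})}=[n,{}^mn']$. For Hom-Leibniz algebras acting on each other, $M\ast N$ is the vector space spanned by all symbols $m\ast n$ and $n\ast m$ ($m\in M$, $n\in N$; the two kinds of symbols are formally distinct), bilinear in both arguments for each kind (so $M\ast N$ is a quotient of $(M\otimes N)\oplus(N\otimes M)$), subject to the following relations for all $m,m'\in M$, $n,n'\in N$: $\alpha_M(m)\ast[n,n']=m^n\ast\alpha_N(n')-m^{n'}\ast\alpha_N(n)$; $\alpha_N(n)\ast[m,m']=n^m\ast\alpha_M(m')-n^{m'}\ast\alpha_M(m)$;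 $[m,m']\ast\alpha_N(n)={}^mn\ast\alpha_M(m')-\alpha_M(m)\ast n^{m'}$; $[n,n']\ast\alpha_M(m)={}^nm\ast\alpha_N(n')-\alpha_N(n)\ast m^{n'}$; $\alpha_M(m)\ast{}^{m'}n=-\alpha_M(m)\ast n^{m'}$; $\alpha_N(n)\ast{}^{n'}m=-\alpha_N(n)\ast m^{n'}$; $m^n\ast{}^{m'}n'={}^mn\ast m'^{\,n'}$; $m^n\ast n'^{\,m'}={}^mn\ast{}^{n'}m'$; ${}^nm\ast{}^{m'}n'=n^m\ast m'^{\,n'}$; ${}^nm\ast n'^{\,m'}=n^m\ast{}^{n'}m'$. Here $m^n,{}^nm\in M$ and ${}^mn,n^m\in N$. The linear map $\alpha_{M\ast N}$ is induced by $\alpha_{M\ast N}(m\ast n)=\alpha_M(m)\ast\alpha_N(n)$ and $\alpha_{M\ast N}(n\ast m)=\alpha_N(n)\ast\alpha_M(m)$. *)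

(* Defs.v *)
From HB Require Import structures.
From mathcomp Require Import all_boot all_algebra generic_quotient.
From mathcomp Require Import ring_quotient sesquilinear boolp freeg.

Set Implicit Arguments.
Unset Strict Implicit.
Unset Printing Implicit Defensive.

Import GRing.Theory.

Local Open Scope ring_scope.
Local Open Scope quotient_scope.

Structure homVect (K : fieldType) := HomVect {
  hv_carrier :> lmodType K;
  twist : {linear hv_carrier -> hv_carrier}
}.

Record is_hom_leibniz (K : fieldType) (V : homVect K)
    (br : {bilinear V -> V -> V}) : Prop := IsHomLeibniz {
  hom_leibniz_identity : forall x y z : V,
    br (twist V x) (br y z) =
      br (br x y) (twist V z) - br (br x z) (twist V y);
  twist_multiplicative : forall x y : V,
    twist V (br x y) = br (twist V x) (twist V y)
}.

Structure homLeibniz (K : fieldType) := HomLeibniz {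
  hl_vect :> homVect K;
  bracket : {bilinear hl_vect -> hl_vect -> hl_vect};
  homLeibnizP : is_hom_leibniz bracket
}.

Local Notation "[[ x , y ]]" := (bracket _ x y)
  (at level 0, format "[[ x ,  y ]]") : ring_scope.

(* [lact A x m] is {}^x m and [ract A m x] is m^x; linear maps out of a tensor *)
(* product are given as bilinear maps.                                         *)
Structure homLeibnizAction (K : fieldType) (L M : homLeibniz K) :=
    HomLeibnizAction {
  lact : {bilinear L -> M -> M};
  ract : {bilinear M -> L -> M};
  act_a : forall (x y : L) (m : M),
    ract (twist M m) [[x, y]] =
      ract (ract m x) (twist L y) - ract (ract m y) (twist L x);
  act_b : forall (x y : L) (m : M),
    lact [[x, y]] (twist M m) =
      ract (lact x m) (twist L y) - lact (twist L x) (ract m y);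
  act_c : forall (x y : L) (m : M),
    lact (twist L x) (lact y m) = - lact (twist L x) (ract m y);
  act_d : forall (x : L) (m m' : M),
    lact (twist L x) [[m, m']] =
      [[lact x m, twist M m']] - [[lact x m', twist M m]];
  act_e : forall (x : L) (m m' : M),
    ract [[m, m']] (twist L x) =
      [[ract m x, twist M m']] + [[twist M m, ract m' x]];
  act_f : forall (x : L) (m m' : M),
    [[twist M m, lact x m']] = - [[twist M m, ract m' x]];
  act_g : forall (x : L) (m : M),
    twist M (lact x m) = lact (twist L x) (twist M m);
  act_h : forall (x : L) (m : M),
    twist M (ract m x) = ract (twist M m) (twist L x)
}.

Record compatible_actions (K : fieldType) (M N : homLeibniz K)
    (aM : homLeibnizAction M N) (aN : homLeibnizAction N M) : Prop :=
    CompatibleActions {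
  compat_ll_M : forall (m m' : M) (n : N),
    lact aN (lact aM m n) m' = [[ract aN m n, m']];
  compat_ll_N : forall (m : M) (n n' : N),
    lact aM (lact aN n m) n' = [[ract aM n m, n']];
  compat_lr_M : forall (m m' : M) (n : N),
    lact aN (ract aM n m) m' = [[lact aN n m, m']];
  compat_lr_N : forall (m : M) (n n' : N),
    lact aM (ract aN m n) n' = [[lact aM m n, n']];
  compat_rl_M : forall (m m' : M) (n : N),
    ract aN m (lact aM m' n) = [[m, ract aN m' n]];
  compat_rl_N : forall (m : M) (n n' : N),
    ract aM n (lact aN n' m) = [[n, ract aM n' m]];
  compat_rr_M : forall (m m' : M) (n : N),
    ract aN m (ract aM n m') = [[m, lact aN n m']];
  compat_rr_N : forall (m : M) (n n' : N),
    ract aM n (ract aN m n') = [[n, lact aM m n']]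
}.

Section Presented.
Variables (K : fieldType) (V : lmodType K) (R : V -> V -> Prop).

Inductive relation_span : V -> Prop :=
| RSpan_rel u v : R u v -> relation_span (u - v)
| RSpan_zero : relation_span 0
| RSpan_lin a u v :
    relation_span u -> relation_span v -> relation_span (a *: u + v).

Definition relation_spanb : {pred V} := fun u => `[< relation_span u >].

Fact relation_span_zmod_closed : zmod_closed relation_spanb.
Proof.
split=> [|u v /asboolP uS /asboolP vS]; apply/asboolP; first exact: RSpan_zero.
by rewrite -[_ - _]addrC -scaleN1r; apply: RSpan_lin.
Qed.

HB.instance Definition _ :=
  GRing.isZmodClosed.Build V relation_spanb relation_span_zmod_closed.

(* The quotient of V by the subspace generated by all u - v with R u v. *)
Definition presented := Quotient.quot relation_spanb.

HB.instance Definition _ := Choice.on presented.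
HB.instance Definition _ := GRing.Zmodule.on presented.

Definition presented_pi (u : V) : presented := \pi u.

Lemma presented_piP u v :
  (presented_pi u = presented_pi v) <-> relation_span (u - v).
Proof.
rewrite /presented_pi; split=> [/eqP|uv].
  by rewrite -Quotient.idealrBE => /asboolP.
by apply/eqP; rewrite -Quotient.idealrBE; apply/asboolP.
Qed.

Lemma presented_piK (x : presented) : presented_pi (repr x) = x.
Proof. exact: reprK. Qed.

Definition presented_scale (a : K) (x : presented) : presented :=
  presented_pi (a *: repr x).

Lemma presented_piD u v :
  presented_pi (u + v) = presented_pi u + presented_pi v.
Proof. by rewrite /presented_pi !piE. Qed.

Lemma presented_scale_pi a u :
  presented_scale a (presented_pi u) = presented_pi (a *: u).
Proof.
apply/presented_piP; rewrite -scalerBr -[_ *: _]addr0.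
by apply: RSpan_lin RSpan_zero; apply/presented_piP; rewrite presented_piK.
Qed.

Fact presented_scaleA a b x :
  presented_scale a (presented_scale b x) = presented_scale (a * b) x.
Proof. by rewrite -[x]presented_piK !presented_scale_pi scalerA. Qed.

Fact presented_scale1 : left_id 1 presented_scale.
Proof. by move=> x; rewrite -[x]presented_piK presented_scale_pi scale1r. Qed.

Fact presented_scaleDr : right_distributive presented_scale +%R.
Proof.
move=> a x y; rewrite -[x]presented_piK -[y]presented_piK -presented_piD.
by rewrite !presented_scale_pi scalerDr presented_piD.
Qed.

Fact presented_scaleDl x :
  {morph presented_scale^~ x : a b / a + b}.
Proof.
move=> a b; rewrite -[x]presented_piK !presented_scale_pi.
by rewrite scalerDl presented_piD.
Qed.

HB.instance Definition _ := GRing.Zmodule_isLmodule.Build K presented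
  presented_scaleA presented_scale1 presented_scaleDr presented_scaleDl.

Fact presented_pi_is_linear : linear presented_pi.
Proof. by move=> a u v; rewrite presented_piD -presented_scale_pi. Qed.

HB.instance Definition _ :=
  GRing.isLinear.Build K V presented *:%R presented_pi presented_pi_is_linear.

Lemma presented_pi_rel u v : R u v -> presented_pi u = presented_pi v.
Proof. by move=> Ruv; apply/presented_piP/RSpan_rel. Qed.

Section Lift.
Variables (W : lmodType K) (f : {linear V -> W}).
Hypothesis fR : forall u v, R u v -> f u = f v.

Definition presented_lift of (forall u v, R u v -> f u = f v) :=
  fun x : presented => f (repr x).

Lemma presented_liftE u : presented_lift fR (presented_pi u) = f u.
Proof.
suff f0 w : relation_span w -> f w = 0.
  apply/eqP; rewrite -subr_eq0 -linearB; apply/eqP/f0/presented_piP.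
  exact: presented_piK.
elim=> [{}u v /fR uv|| a {}u v _ u0 _ v0]; rewrite ?linear0 //.
  by rewrite linearB uv subrr.
by rewrite linearP u0 v0 scaler0 addr0.
Qed.

Fact presented_lift_is_linear : linear (presented_lift fR).
Proof.
move=> a x y; rewrite -[x]presented_piK -[y]presented_piK -linearP.
by rewrite !presented_liftE linearP.
Qed.

HB.instance Definition _ := GRing.isLinear.Build K presented W *:%R
  (presented_lift fR) presented_lift_is_linear.
End Lift.
End Presented.

Section FreeLift.
Variables (K : fieldType) (S : choiceType) (W : lmodType K) (f : S -> W).

Definition free_lift : {freeg S / K} -> W := fglift f.

Fact free_lift_is_linear : linear free_lift.
Proof.
have lB : {morph free_lift : u v / u - v} by exact: lift_is_additive.
have l0 : free_lift 0 = 0 by rewrite -(subrr 0) lB subrr.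
have lD : {morph free_lift : u v / u + v}.
  by move=> u v; rewrite -[v in LHS]opprK lB -[- v]sub0r lB l0 sub0r opprK.
move=> a u v; rewrite lD; congr (_ + _).
have lsum (r : seq S) (F : S -> {freeg S / K}) :
    free_lift (\sum_(x <- r) F x) = \sum_(x <- r) free_lift (F x).
  exact: (big_morph _ lD l0).
rewrite -[u in RHS]freeg_sumE lsum [in LHS]/GRing.scale /= /fgscale lsum.
by rewrite scaler_sumr; apply: eq_bigr => x _; rewrite /free_lift !liftU scalerA.
Qed.

HB.instance Definition _ := GRing.isLinear.Build K {freeg S / K} W *:%R
  free_lift free_lift_is_linear.
End FreeLift.

Section Star.
Variables (K : fieldType) (M N : homLeibniz K).
Variables (aM : homLeibnizAction M N) (aN : homLeibnizAction N M).

Definition star_symbol : choiceType := (M * N + N * M)%type.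
Definition star_free : lmodType K := {freeg star_symbol / K}.

Definition symMN (m : M) (n : N) : star_free := << (inl (m, n) : star_symbol) >>.
Definition symNM (n : N) (m : M) : star_free := << (inr (n, m) : star_symbol) >>.

Local Notation "m '*MN' n" := (symMN m n) (at level 40).
Local Notation "n '*NM' m" := (symNM n m) (at level 40).

Inductive star_relation : star_free -> star_free -> Prop :=
| Star_MN_linl (a : K) (m m' : M) (n : N) :
    star_relation ((a *: m + m') *MN n) (a *: (m *MN n) + m' *MN n)
| Star_MN_linr (a : K) (m : M) (n n' : N) :
    star_relation (m *MN (a *: n + n')) (a *: (m *MN n) + m *MN n')
| Star_NM_linl (a : K) (n n' : N) (m : M) :
    star_relation ((a *: n + n') *NM m) (a *: (n *NM m) + n' *NM m)
| Star_NM_linr (a : K) (n : N) (m m' : M) :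
    star_relation (n *NM (a *: m + m')) (a *: (n *NM m) + n *NM m')
| Star_1 (m : M) (n n' : N) :
    star_relation (twist M m *MN [[n, n']])
      (ract aN m n *MN twist N n' - ract aN m n' *MN twist N n)
| Star_2 (m m' : M) (n : N) :
    star_relation (twist N n *NM [[m, m']])
      (ract aM n m *NM twist M m' - ract aM n m' *NM twist M m)
| Star_3 (m m' : M) (n : N) :
    star_relation ([[m, m']] *MN twist N n)
      (lact aM m n *NM twist M m' - twist M m *MN ract aM n m')
| Star_4 (m : M) (n n' : N) :
    star_relation ([[n, n']] *NM twist M m)
      (lact aN n m *MN twist N n' - twist N n *NM ract aN m n')
| Star_5 (m m' : M) (n : N) :
    star_relation (twist M m *MN lact aM m' n) (- (twist M m *MN ract aM n m'))
| Star_6 (m : M) (n n' : N) :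
    star_relation (twist N n *NM lact aN n' m) (- (twist N n *NM ract aN m n'))
| Star_7 (m m' : M) (n n' : N) :
    star_relation (ract aN m n *MN lact aM m' n') (lact aM m n *NM ract aN m' n')
| Star_8 (m m' : M) (n n' : N) :
    star_relation (ract aN m n *MN ract aM n' m') (lact aM m n *NM lact aN n' m')
| Star_9 (m m' : M) (n n' : N) :
    star_relation (lact aN n m *MN lact aM m' n') (ract aM n m *NM ract aN m' n')
| Star_10 (m m' : M) (n n' : N) :
    star_relation (lact aN n m *MN ract aM n' m') (ract aM n m *NM lact aN n' m').

Definition star_space : lmodType K := presented star_relation.

Definition starMN (m : M) (n : N) : star_space :=
  presented_pi star_relation (m *MN n).
Definition starNM (n : N) (m : M) : star_space :=
  presented_pi star_relation (n *NM m).

Definition star_twist_sym (s : star_symbol) : star_space :=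
  match s with
  | inl (m, n) => starMN (twist M m) (twist N n)
  | inr (n, m) => starNM (twist N n) (twist M m)
  end.

Fact star_twist_rel u v : star_relation u v ->
  free_lift star_twist_sym u = free_lift star_twist_sym v.
Proof.
have TMN m n : free_lift star_twist_sym (m *MN n) =
    presented_pi star_relation (twist M m *MN twist N n).
  by rewrite [LHS]liftU scale1r.
have TNM n m : free_lift star_twist_sym (n *NM m) =
    presented_pi star_relation (twist N n *NM twist M m).
  by rewrite [LHS]liftU scale1r.
pose p := presented_pi star_relation.
have piP a x y : p (a *: x + y) = a *: p x + p y by exact: linearP.
have piB x y : p (x - y) = p x - p y by exact: linearB.
have piN x : p (- x) = - p x by exact: linearN.
have mulM := twist_multiplicative (homLeibnizP M).
have mulN := twist_multiplicative (homLeibnizP N).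
case=> *; rewrite ?(linearP, linearB, linearN) /= ?(TMN, TNM);
  rewrite ?(linearP, mulM, mulN, act_g, act_h) -?(piP, piB, piN);
  apply: presented_pi_rel; by constructor.
Qed.

Definition star_twist : {linear star_space -> star_space} :=
  presented_lift star_twist_rel.

Lemma star_twistMN m n :
  star_twist (starMN m n) = starMN (twist M m) (twist N n).
Proof. by rewrite [LHS]presented_liftE [LHS]liftU scale1r. Qed.

Lemma star_twistNM n m :
  star_twist (starNM n m) = starNM (twist N n) (twist M m).
Proof. by rewrite [LHS]presented_liftE [LHS]liftU scale1r. Qed.

Definition star : homVect K := HomVect star_twist.

Record bracket_on_generators (br : star -> star -> star) : Prop :=
    BracketOnGenerators {
  bracket_MN_MN : forall (m m' : M) (n n' : N),
    br (starMN m n) (starMN m' n') = starMN (ract aN m n) (lact aM m' n');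
  bracket_MN_NM : forall (m m' : M) (n n' : N),
    br (starMN m n) (starNM n' m') = starMN (ract aN m n) (ract aM n' m');
  bracket_NM_MN : forall (m m' : M) (n n' : N),
    br (starNM n m) (starMN m' n') = starMN (lact aN n m) (lact aM m' n');
  bracket_NM_NM : forall (m m' : M) (n n' : N),
    br (starNM n m) (starNM n' m') = starMN (lact aN n m) (ract aM n' m')
}.
End Star.

(* Main.v *)
Require Import Defs.
From HB Require Import structures.
From mathcomp Require Import all_boot all_algebra sesquilinear freeg.

Set Implicit Arguments.
Unset Strict Implicit.
Unset Printing Implicit Defensive.

Import GRing.Theory.
Local Open Scope ring_scope.

(** The four formulas for the bracket are a single one.  The two actions give
    two linear maps out of the star product,
      [to_M : m * n |-> m^n, n * m |-> ^n m]   and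
      [to_N : m * n |-> ^m n, n * m |-> n^m],
    and the bracket of x and y has to be the symbol [to_M x * to_N y].  So it
    exists as soon as [to_M] and [to_N] respect the defining relations of the
    star product ([to_M_rel], [to_N_rel]): once the compatibility conditions
    have rewritten every iterated action as a bracket, these relations become
    axioms of the actions.  Uniqueness holds because the generators span.

    Since [to_M] and [to_N] commute with the twists, the bracket is
    multiplicative.  For the Hom-Leibniz identity at x, y, z, put m = to_M x,
    n = to_N y and n' = to_N z.  Applying [to_M] to the bracket of x and y gives
    m^n.  Applying [to_N] to the bracket of y and z gives the left action of
    to_M y on n', and this is the bracket of n and n' in N by compatibility
    ([lact_to_M_to_N]).  The identity therefore reads
      [alpha m * [n, n'] = m^n * alpha n' - m^n' * alpha n],
    which is the relation [Star_1]. *)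

Section StarTheory.
Variables (K : fieldType) (M N : homLeibniz K).
Variables (aM : homLeibnizAction M N) (aN : homLeibnizAction N M).
Local Notation star := (star aM aN).
Local Notation starMN := (starMN aM aN).
Local Notation starNM := (starNM aM aN).

(** Zero needs no case of its own, because 0 = (-1) g + g for a generator g. *)
Lemma star_span_ind (P : star -> Prop) :
    (forall m n, P (starMN m n)) -> (forall n m, P (starNM n m)) ->
    (forall a x y, P x -> P y -> P (a *: x + y)) ->
  forall x, P x.
Proof.
move=> P_MN P_NM P_lin.
have P0 : P 0.
  rewrite -(addNr (starMN 0 0)) -scaleN1r.
  by apply: P_lin; apply: P_MN.
move=> x; rewrite -[x]presented_piK -[repr x]freeg_sumE linear_sum.
elim/big_rec: _ => // s y _.
have -> : << coeff s (repr x) *g s >> =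
    coeff s (repr x) *: (<< s >> : star_free M N).
  by apply/eqP/freeg_eqP => t; rewrite coeff_fgscale !coeffU mul1r.
rewrite linearZ; apply: P_lin.
by case: s => -[u v]; [apply: P_MN | apply: P_NM].
Qed.

Fact starMN_is_bilinear : bilinear_for *:%R *:%R starMN.
Proof.
split=> [n a m m'|m a n n']; rewrite -linearP; apply: presented_pi_rel;
  by constructor.
Qed.

HB.instance Definition _ := bilinear_isBilinear.Build K M N star *:%R *:%R
  starMN starMN_is_bilinear.

Definition to_M_sym (s : star_symbol M N) : M :=
  match s with inl (m, n) => ract aN m n | inr (n, m) => lact aN n m end.

Definition to_N_sym (s : star_symbol M N) : N :=
  match s with inl (m, n) => lact aM m n | inr (n, m) => ract aM n m end.

Hypothesis compat : compatible_actions aM aN.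

(** Compatibility turns the iterated actions of N on M into brackets of M.  Then
    [Star_7] to [Star_10] hold by reflexivity, while [Star_1] to [Star_6] become
    the axioms [act_a], [act_d], [act_e], [act_b], [act_f], [act_c] of the
    action of N on M, with [act_f] also matching the signs in [Star_3]. *)
Fact to_M_rel u v : star_relation aM aN u v ->
  free_lift to_M_sym u = free_lift to_M_sym v.
Proof.
have LMN m n : free_lift to_M_sym (symMN m n) = ract aN m n.
  by rewrite [LHS]liftU scale1r.
have LNM n m : free_lift to_M_sym (symNM n m) = lact aN n m.
  by rewrite [LHS]liftU scale1r.
case: compat => llM _ lrM _ rlM _ rrM _.
case=> *; rewrite ?(linearP, linearB, linearN) /= ?(LMN, LNM).
all: rewrite ?(linearPl, linearPr, llM, lrM, rlM, rrM) //.
- exact: act_a.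
- exact: act_d.
- by rewrite act_e act_f opprK.
- exact: act_b.
- by rewrite act_f opprK.
- exact: act_c.
Qed.

(** The relations come in pairs exchanged by swapping M and N, so the axioms of
    [to_M_rel] reappear here for the action of M on N, transposed in pairs. *)
Fact to_N_rel u v : star_relation aM aN u v ->
  free_lift to_N_sym u = free_lift to_N_sym v.
Proof.
have LMN m n : free_lift to_N_sym (symMN m n) = lact aM m n.
  by rewrite [LHS]liftU scale1r.
have LNM n m : free_lift to_N_sym (symNM n m) = ract aM n m.
  by rewrite [LHS]liftU scale1r.
case: compat => _ llN _ lrN _ rlN _ rrN.
case=> *; rewrite ?(linearP, linearB, linearN) /= ?(LMN, LNM).
all: rewrite ?(linearPl, linearPr, llN, lrN, rlN, rrN) //.
- exact: act_d.
- exact: act_a.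
- exact: act_b.
- by rewrite act_e act_f opprK.
- exact: act_c.
- by rewrite act_f opprK.
Qed.

Definition to_M : {linear star -> M} := presented_lift to_M_rel.
Definition to_N : {linear star -> N} := presented_lift to_N_rel.

Lemma to_M_MN m n : to_M (starMN m n) = ract aN m n.
Proof. by rewrite [LHS]presented_liftE [LHS]liftU scale1r. Qed.

Lemma to_M_NM n m : to_M (starNM n m) = lact aN n m.
Proof. by rewrite [LHS]presented_liftE [LHS]liftU scale1r. Qed.

Lemma to_N_MN m n : to_N (starMN m n) = lact aM m n.
Proof. by rewrite [LHS]presented_liftE [LHS]liftU scale1r. Qed.

Lemma to_N_NM n m : to_N (starNM n m) = ract aM n m.
Proof. by rewrite [LHS]presented_liftE [LHS]liftU scale1r. Qed.

Lemma to_M_twist x : to_M (twist star x) = twist M (to_M x).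
Proof.
elim/star_span_ind: x => [m n|n m|a x y IHx IHy].
- by rewrite [twist _ _]star_twistMN !to_M_MN act_h.
- by rewrite [twist _ _]star_twistNM !to_M_NM act_g.
- by rewrite !linearP IHx IHy.
Qed.

Lemma to_N_twist x : to_N (twist star x) = twist N (to_N x).
Proof.
elim/star_span_ind: x => [m n|n m|a x y IHx IHy].
- by rewrite [twist _ _]star_twistMN !to_N_MN act_g.
- by rewrite [twist _ _]star_twistNM !to_N_NM act_h.
- by rewrite !linearP IHx IHy.
Qed.

(** Where [Star_1] needs a bracket in its second factor, the Hom-Leibniz
    identity produces a left action; compatibility equates them. *)
Lemma lact_to_M_to_N x n : lact aM (to_M x) n = bracket N (to_N x) n.
Proof.
elim/star_span_ind: x => [m n'|n' m|a x y IHx IHy].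
- by rewrite to_M_MN to_N_MN (compat_lr_N compat).
- by rewrite to_M_NM to_N_NM (compat_ll_N compat).
- by rewrite !linearP !linearPl IHx IHy.
Qed.

Definition star_bracket (x y : star) : star := starMN (to_M x) (to_N y).

Fact star_bracket_is_bilinear : bilinear_for *:%R *:%R star_bracket.
Proof.
split=> [y a x x'|x a y y']; rewrite /star_bracket linearP.
  exact: linearPl.
exact: linearPr.
Qed.

HB.instance Definition _ := bilinear_isBilinear.Build K star star star
  *:%R *:%R star_bracket star_bracket_is_bilinear.

Lemma star_bracketP : bracket_on_generators star_bracket.
Proof.
by split=> *; rewrite /star_bracket ?(to_M_MN, to_M_NM) ?(to_N_MN, to_N_NM).
Qed.

Lemma star_bracket_hom_leibniz : is_hom_leibniz star_bracket.
Proof.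
split=> [x y z|x y]; rewrite /= /star_bracket.
  rewrite to_M_twist !to_N_MN lact_to_M_to_N !to_M_MN !to_N_twist.
  rewrite /starMN -linearB; apply: presented_pi_rel; exact: Star_1.
by rewrite [LHS]star_twistMN to_M_twist to_N_twist.
Qed.

End StarTheory.

Lemma bracket_on_generators_unique (K : fieldType) (M N : homLeibniz K)
    (aM : homLeibnizAction M N) (aN : homLeibnizAction N M)
    (br br' : {bilinear star aM aN -> star aM aN -> star aM aN}) :
  bracket_on_generators br -> bracket_on_generators br' -> br =2 br'.
Proof.
case=> MM MN NM NN [MM' MN' NM' NN'] x y.
elim/star_span_ind: x => [m n|n m|a x1 x2 IH1 IH2]; last first.
- by rewrite !linearPl IH1 IH2.
- elim/star_span_ind: y => [m' n'|n' m'|a y1 y2 IH1 IH2].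
  + by rewrite NM NM'.
  + by rewrite NN NN'.
  + by rewrite !linearPr IH1 IH2.
- elim/star_span_ind: y => [m' n'|n' m'|a y1 y2 IH1 IH2].
  + by rewrite MM MM'.
  + by rewrite MN MN'.
  + by rewrite !linearPr IH1 IH2.
Qed.

Theorem proposition3p3 (K : fieldType) (M N : homLeibniz K)
    (aM : homLeibnizAction M N) (aN : homLeibnizAction N M)
    (compat : compatible_actions aM aN) :
  exists br : {bilinear star aM aN -> star aM aN -> star aM aN},
    [/\ bracket_on_generators br,
        forall br' : {bilinear star aM aN -> star aM aN -> star aM aN},
          bracket_on_generators br' -> br' =2 br
      & is_hom_leibniz br].
Proof.
exists (star_bracket compat); split.
- exact: star_bracketP.
- by move=> br' br'P; apply: bracket_on_generators_unique br'P
    (star_bracketP compat).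
- exact: star_bracket_hom_leibniz.
Qed.
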